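(* Let $D$ be an integral domain. (1) There exists a $D$-$D$-biring structure on the $D$-algebra $\operatorname{Int}(D)$ if and only if there exists a lift of the functor $\operatorname{Hom}_D(\operatorname{Int}(D),-)$ from $D$-algebras to sets to a functor from $D$-algebras to $D$-algebras. (2) A $D$-$D$-biring structure on $\operatorname{Int}(D)$ is compatible with the $D$-$D$-biring structure on $D[X]$, that is, the inclusion $D[X] \to \operatorname{Int}(D)$ is a homomorphism of $D$-$D$-birings, if and only if the natural map $\operatorname{Hom}_D(\operatorname{Int}(D),A) \to A$ given by $\varphi \mapsto \varphi(X)$ is a $D$-algebra homomorphism for every $D$-algebra $A$ (where $\operatorname{Hom}_D(\operatorname{Int}(D),A)$ carries the $D$-algebra structure determined by the given biring structure).
   Context: All rings and algebras are commutative with identity. For an integral domain $D$ with quotient field $K$, $\operatorname{Int}(D)=\{f\in K[X] : f(D)\subseteq D\}$. For $D$-algebras $S,R$, $\operatorname{Hom}_D(S,R)$ is the set of $D$-algebra homomorphisms. Birings. Let $A,B$ be rings. An $A$-$B$-biring is an $A$-algebra $S$ together with the structure on $S$ of a $B$-algebra object in the opposite category of the category of $A$-algebras. Explicitly, $S$ is equipped with $A$-algebra homomorphisms $\Delta^+,\Delta^\times: S\to S\otimes_A S$ (co-addition and co-multiplication) and a co-$B$-linear structure $\beta: B\to \operatorname{Hom}_A(S,A)$, satisfying the duals of the laws defining $B$-algebras (co-zero, co-one and co-negation being part of this structure, with co-zero $\beta(0)$ and co-one $\beta(1)$). For each $A$-algebra $R$ this makes $\operatorname{Hom}_A(S,R)$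 a $B$-algebra: the sum (resp. product) of $\varphi,\psi$ is the composite of $\Delta^+$ (resp. $\Delta^\times$) with $S\otimes_A S\to R$, $s\otimes t\mapsto\varphi(s)\psi(t)$, and $b\in B$ is sent to the composite of $\beta(b): S\to A$ with $A\to R$. A homomorphism of $A$-$B$-birings is an $A$-algebra homomorphism compatible with $\Delta^+$, $\Delta^\times$ and $\beta$. The polynomial ring $A[X]$ is an $A$-$A$-biring with $\Delta^+(X)=X\otimes1+1\otimes X$, $\Delta^\times(X)=X\otimes X$, $\beta(a)(f)=f(a)$. A lift of $\operatorname{Hom}_D(S,-)$ to a functor to $D$-algebras is a functor from $D$-algebras to $D$-algebras whose composition with the forgetful functor to sets is $\operatorname{Hom}_D(S,-)$. *)

(* Defs.v *)
From HB Require Import structures.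
From mathcomp Require Import all_boot all_order all_algebra.
From mathcomp Require Import boolp.

Set Implicit Arguments.
Unset Strict Implicit.
Unset Printing Implicit Defensive.

Import GRing.Theory.
Local Open Scope ring_scope.
Local Open Scope quotient_scope.

(* The library's [comAlgType A] requires 0 != 1, but the zero ring is an      *)
(* object of the category of A-algebras: an A-algebra is here a commutative,  *)
(* possibly zero, ring V with a ring homomorphism A -> V.                     *)
HB.mixin Record isPzComAlg (A : comPzRingType) V of GRing.ComPzRing V := {
  algmap : A -> V;
  algmap_is_zmod_morphism : zmod_morphism algmap;
  algmap_is_monoid_morphism : monoid_morphism algmap
}.

#[short(type="pzComAlgType")]
HB.structure Definition PzComAlg (A : comPzRingType) :=
  {V of GRing.ComPzRing V & isPzComAlg A V}.

HB.instance Definition _ (A : comPzRingType) (V : pzComAlgType A) :=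
  GRing.isZmodMorphism.Build A V algmap algmap_is_zmod_morphism.
HB.instance Definition _ (A : comPzRingType) (V : pzComAlgType A) :=
  GRing.isMonoidMorphism.Build A V algmap algmap_is_monoid_morphism.

Lemma id_is_monoid_morphism (A : pzRingType) : monoid_morphism (id : A -> A).
Proof. by []. Qed.

HB.instance Definition _ (A : comPzRingType) :=
  isPzComAlg.Build A A^o (fun _ _ => erefl) (id_is_monoid_morphism A).

Definition is_algHom (A : comPzRingType) (S R : pzComAlgType A) (f : S -> R) :=
  [/\ zmod_morphism f, monoid_morphism f
    & forall a : A, f (algmap a) = algmap a].

Record algHom (A : comPzRingType) (S R : pzComAlgType A) := AlgHom {
  algHom_fun :> S -> R;
  algHomP : is_algHom algHom_fun
}.

Section AlgHom.
Variables (A : comPzRingType).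
Implicit Types S T R U : pzComAlgType A.

HB.instance Definition _ S R (f : algHom S R) :=
  GRing.isZmodMorphism.Build S R f (let: And3 h _ _ := algHomP f in h).
HB.instance Definition _ S R (f : algHom S R) :=
  GRing.isMonoidMorphism.Build S R f (let: And3 _ h _ := algHomP f in h).
Lemma algHom_algmap S R (f : algHom S R) (a : A) : f (algmap a) = algmap a.
Proof. by case: f => f []. Qed.

Lemma algHom_ext S R (f g : algHom S R) : f =1 g -> f = g.
Proof.
case: f g => [f fP] [g gP] /= /funext fg; subst g.
by rewrite (Prop_irrelevance fP gP).
Qed.

Lemma algHomD S R (f : algHom S R) x y : f (x + y) = f x + f y.
Proof. exact: rmorphD. Qed.
Lemma algHom1 S R (f : algHom S R) : f 1 = 1.
Proof. exact: rmorph1. Qed.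

Lemma id_is_algHom S : is_algHom (@id S). Proof. by []. Qed.
Definition idHom S : algHom S S := AlgHom (id_is_algHom S).

Lemma comp_is_algHom S T R (g : algHom T R) (f : algHom S T) :
  is_algHom (g \o f).
Proof.
split=> [x y|| a] /=; first by rewrite !rmorphB.
  by split=> [|x y] /=; rewrite ?rmorph1 ?rmorphM.
by rewrite !algHom_algmap.
Qed.
Definition compHom S T R (g : algHom T R) (f : algHom S T) : algHom S R :=
  AlgHom (comp_is_algHom g f).

Local Notation "g \oH f" := (compHom g f) (at level 50, left associativity).

Lemma compHomE S T R (g : algHom T R) (f : algHom S T) x :
  (g \oH f) x = g (f x).
Proof. by []. Qed.

Lemma unit_is_algHom R : is_algHom (@algmap A R : A^o -> R).
Proof.
split=> [x y|| a] //; first exact: rmorphB.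
by split=> [|x y]; [exact: rmorph1|exact: rmorphM].
Qed.
Definition unitHom R : algHom A^o R := AlgHom (unit_is_algHom R).

End AlgHom.

HB.instance Definition _ (A : comPzRingType) (S R : pzComAlgType A) :=
  gen_eqMixin (algHom S R).
HB.instance Definition _ (A : comPzRingType) (S R : pzComAlgType A) :=
  gen_choiceMixin (algHom S R).

Notation "g \oH f" := (compHom g f) (at level 50, left associativity).

Section Tensor.
Variables (A : comPzRingType) (S T : pzComAlgType A).

(* A sequence of pairs (s, t) stands for the sum of the s (x) t. The relation *)
(* below presents the A-module S (x)_A T: no formal opposites are needed,     *)
(* since (-s) (x) t is opposite to s (x) t, and s (x) 0 = 0 follows from      *)
(* [tc_zero] and [tc_scale] with a = 0.                                       *)
Inductive tcong : seq (S * T) -> seq (S * T) -> Prop :=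
| tc_refl u : tcong u u
| tc_sym u v : tcong u v -> tcong v u
| tc_trans u v w : tcong u v -> tcong v w -> tcong u w
| tc_cat u u' v v' : tcong u u' -> tcong v v' -> tcong (u ++ v) (u' ++ v')
| tc_comm u v : tcong (u ++ v) (v ++ u)
| tc_zero t : tcong [:: (0, t)] [::]
| tc_addl s s' t : tcong [:: (s + s', t)] [:: (s, t); (s', t)]
| tc_addr s t t' : tcong [:: (s, t + t')] [:: (s, t); (s, t')]
| tc_scale (a : A) s t : tcong [:: (algmap a * s, t)] [:: (s, algmap a * t)].

Definition tcongb (u v : seq (S * T)) : bool := `[< tcong u v >].

Lemma tcongb_equiv : equiv_class_of tcongb.
Proof.
split=> [u|u v|v u w].
- exact/asboolP/tc_refl.
- by apply/asboolP/asboolP; apply: tc_sym.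
- by move=> /asboolP uv /asboolP vw; apply/asboolP/(tc_trans uv vw).
Qed.
Canonical tcong_equiv := EquivRelPack tcongb_equiv.

Definition tensor := {eq_quot tcong_equiv}.
HB.instance Definition _ := Choice.on tensor.

Definition tpi (u : seq (S * T)) : tensor := \pi u.

Lemma tpiP u v : tpi u = tpi v <-> tcong u v.
Proof.
split=> [/eqP|uv]; first by rewrite /tpi eqmodE => /asboolP.
by apply/eqP; rewrite /tpi eqmodE; apply/asboolP.
Qed.

Lemma tpi_surj (x : tensor) : tpi (repr x) = x. Proof. exact: reprK. Qed.

Lemma tcong_repr u : tcong (repr (tpi u)) u.
Proof. by apply/tpiP; rewrite tpi_surj. Qed.

Variant tpi_spec : tensor -> Prop := TpiSpec u : tpi_spec (tpi u).
Lemma tpi_case x : tpi_spec x.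
Proof. by rewrite -(tpi_surj x). Qed.

(* A map on formal sums given termwise descends as soon as it respects the    *)
(* generating relations.                                                      *)
Definition tneg1 (p : S * T) : S * T := (- p.1, p.2).
Definition tmul1 (p q : S * T) : S * T := (p.1 * q.1, p.2 * q.2).

Lemma tcong_map (f : S * T -> S * T) :
    (forall t, tcong [:: f (0, t)] [::]) ->
    (forall s s' t, tcong [:: f (s + s', t)] [:: f (s, t); f (s', t)]) ->
    (forall s t t', tcong [:: f (s, t + t')] [:: f (s, t); f (s, t')]) ->
    (forall (a : A) s t,
      tcong [:: f (algmap a * s, t)] [:: f (s, algmap a * t)]) ->
  forall u v, tcong u v -> tcong (map f u) (map f v).
Proof.
move=> f0 fl fr fs u v; elim=> {u v} /=.
- by move=> u; apply: tc_refl.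
- by move=> u v _; apply: tc_sym.
- by move=> u v w _ uv _; apply: tc_trans.
- by move=> u u' v v' _ uu' _ vv'; rewrite !map_cat; apply: tc_cat.
- by move=> u v; rewrite !map_cat; apply: tc_comm.
- exact: f0.
- exact: fl.
- exact: fr.
- exact: fs.
Qed.

Lemma tcong_neg u v : tcong u v -> tcong (map tneg1 u) (map tneg1 v).
Proof.
apply: tcong_map => *; rewrite /tneg1 /= ?oppr0 ?opprD -?mulrN.
- exact: tc_zero.
- exact: tc_addl.
- exact: tc_addr.
- exact: tc_scale.
Qed.

Definition tmuls (u v : seq (S * T)) := [seq tmul1 p q | p <- u, q <- v].

Lemma tmuls_catl u u' v : tmuls (u ++ u') v = tmuls u v ++ tmuls u' v.
Proof. by rewrite /tmuls map_cat flatten_cat. Qed.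

Lemma tcong_cons p u v : tcong u v -> tcong (p :: u) (p :: v).
Proof. exact/(tc_cat (tc_refl [:: p])). Qed.

Lemma tcong_catCA u v w : tcong (u ++ v ++ w) (v ++ u ++ w).
Proof.
by rewrite !catA; apply: tc_cat; [exact: tc_comm|exact: tc_refl].
Qed.

Lemma tmulsC u v : tcong (tmuls u v) (tmuls v u).
Proof.
elim: u v => [|p u IH] v.
  by elim: v => [|q v IHv] //=; apply: tc_refl.
rewrite -cat1s tmuls_catl.
apply: (@tc_trans _ (tmuls v [:: p] ++ tmuls v u)).
  apply: tc_cat; last exact: IH.
  rewrite /tmuls /= cats0; elim: v => [|q v IHv] /=; first exact: tc_refl.
  rewrite {1}/tmul1 mulrC [_.2 * _.2]mulrC; exact: tcong_cons.
elim: v {IH} => [|q v IHv]; first exact: tc_refl.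
rewrite -[q :: v]cat1s !tmuls_catl /= cats0.
apply: tc_sym; apply: (@tc_trans _ (tmuls [:: q] [:: p] ++
    tmuls [:: q] u ++ tmuls v [:: p] ++ tmuls v u)).
  rewrite /tmuls /= !cats0; apply: tcong_cons; apply: tc_cat; first exact: tc_refl.
  exact: tc_sym.
by apply: tcong_cons; apply: tcong_catCA.
Qed.

Lemma tcong_mulsr u v v' : tcong v v' -> tcong (tmuls u v) (tmuls u v').
Proof.
move=> vv'; elim: u => [|p u IH] /=; first exact: tc_refl.
rewrite /tmuls /=; apply: tc_cat; last exact: IH.
move: v v' vv' {IH}; apply: tcong_map => [t|s s' t|s t t'|a s t];
  rewrite /tmul1 /= ?mulr0 ?mulrDr.
- exact: tc_zero.
- exact: tc_addl.
- exact: tc_addr.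
- by rewrite !(mulrCA _ (algmap a)); apply: tc_scale.
Qed.

Lemma tcong_muls u u' v v' :
  tcong u u' -> tcong v v' -> tcong (tmuls u v) (tmuls u' v').
Proof.
move=> uu' vv'; apply: tc_trans (tcong_mulsr _ vv').
apply: tc_trans (tmulsC _ _) _; apply: tc_trans (tmulsC _ _).
exact: tcong_mulsr.
Qed.

Definition tadd (x y : tensor) : tensor := tpi (repr x ++ repr y).
Definition topp (x : tensor) : tensor := tpi (map tneg1 (repr x)).
Definition tmul (x y : tensor) : tensor := tpi (tmuls (repr x) (repr y)).

Lemma taddE u v : tadd (tpi u) (tpi v) = tpi (u ++ v).
Proof. by apply/tpiP/tc_cat; apply: tcong_repr. Qed.
Lemma toppE u : topp (tpi u) = tpi (map tneg1 u).
Proof. by apply/tpiP/tcong_neg/tcong_repr. Qed.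
Lemma tmulE u v : tmul (tpi u) (tpi v) = tpi (tmuls u v).
Proof. by apply/tpiP/tcong_muls; apply: tcong_repr. Qed.

Lemma taddA : associative tadd.
Proof.
by case/tpi_case=> u; case/tpi_case=> v; case/tpi_case=> w; rewrite !taddE catA.
Qed.
Lemma taddC : commutative tadd.
Proof.
by case/tpi_case=> u; case/tpi_case=> v; rewrite !taddE; apply/tpiP/tc_comm.
Qed.
Lemma tadd0 : left_id (tpi [::]) tadd.
Proof. by case/tpi_case=> u; rewrite taddE. Qed.
Lemma taddN : left_inverse (tpi [::]) topp tadd.
Proof.
case/tpi_case=> u; rewrite toppE taddE; apply/tpiP.
elim: u => [|[s t] u IH] /=; first exact: tc_refl.
apply: (@tc_trans _ ([:: (- s, t); (s, t)] ++ (map tneg1 u ++ u))).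
  apply: tcong_cons; exact: (tcong_catCA _ [:: _]).
apply: (@tc_trans _ ([::] ++ [::])); last exact: tc_refl.
apply: tc_cat => //; apply: tc_trans (tc_zero t).
by apply: tc_sym; rewrite -(addNr s); apply: tc_addl.
Qed.

HB.instance Definition _ := GRing.isZmodule.Build tensor taddA taddC tadd0 taddN.

Lemma tensorDE u v : tpi (u ++ v) = tpi u + tpi v.
Proof. by rewrite -taddE. Qed.

Lemma tmulA : associative tmul.
Proof.
case/tpi_case=> u; case/tpi_case=> v; case/tpi_case=> w; rewrite !tmulE.
congr tpi; elim: u => [|p u IH] //.
rewrite -cat1s !tmuls_catl IH; congr (_ ++ _).
rewrite {1 3 4}/tmuls /= !cats0 => {u IH}; elim: v => [|q v IH] //=.
rewrite -(cat1s q) -cat1s !tmuls_catl map_cat {}IH; congr (_ ++ _).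
rewrite /tmuls /= !cats0 -map_comp; apply: eq_map => r.
by rewrite /tmul1 /= !mulrA.
Qed.
Lemma tmulC : commutative tmul.
Proof.
by case/tpi_case=> u; case/tpi_case=> v; rewrite !tmulE; apply/tpiP/tmulsC.
Qed.
Lemma tmul1l : left_id (tpi [:: (1, 1)]) tmul.
Proof.
case/tpi_case=> u; rewrite tmulE /tmuls /= cats0; congr tpi.
by elim: u => [|[s t] u IH] //=; rewrite IH /tmul1 /= !mul1r.
Qed.
Lemma tmulDl : left_distributive tmul +%R.
Proof.
case/tpi_case=> u; case/tpi_case=> v; case/tpi_case=> w.
by rewrite -tensorDE !tmulE -tensorDE tmuls_catl.
Qed.

HB.instance Definition _ :=
  GRing.Zmodule_isComPzRing.Build tensor tmulA tmulC tmul1l tmulDl.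

Definition tens (s : S) (t : T) : tensor := tpi [:: (s, t)].

Lemma tpi_sum u : tpi u = \sum_(p <- u) tens p.1 p.2.
Proof.
elim: u => [|[s t] u IH]; first by rewrite big_nil.
by rewrite big_cons -IH -cat1s tensorDE.
Qed.

Lemma tensDl s s' t : tens (s + s') t = tens s t + tens s' t.
Proof. by rewrite -tensorDE; apply/tpiP/tc_addl. Qed.
Lemma tensDr s t t' : tens s (t + t') = tens s t + tens s t'.
Proof. by rewrite -tensorDE; apply/tpiP/tc_addr. Qed.
Lemma tensZ (a : A) s t : tens (algmap a * s) t = tens s (algmap a * t).
Proof. exact/tpiP/tc_scale. Qed.
Lemma tensM s s' t t' : tens s t * tens s' t' = tens (s * s') (t * t').
Proof. by rewrite [LHS]tmulE. Qed.
Lemma tens1 : tens 1 1 = 1. Proof. by []. Qed.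

Lemma tens0l t : tens 0 t = 0.
Proof. by apply: (addIr (tens 0 t)); rewrite -tensDl !add0r. Qed.
Lemma tens0r s : tens s 0 = 0.
Proof. by apply: (addIr (tens s 0)); rewrite -tensDr !add0r. Qed.
Lemma tensBl s s' t : tens (s - s') t = tens s t - tens s' t.
Proof. by apply: (addIr (tens s' t)); rewrite -tensDl !subrK. Qed.
Lemma tensBr s t t' : tens s (t - t') = tens s t - tens s t'.
Proof. by apply: (addIr (tens s t')); rewrite -tensDr !subrK. Qed.

Definition talg (a : A) : tensor := tens (algmap a) 1.

Lemma talg_is_zmod_morphism : zmod_morphism talg.
Proof. by move=> a b; rewrite /talg rmorphB tensBl. Qed.
Lemma talg_is_monoid_morphism : monoid_morphism talg.
Proof. by split=> [|a b]; rewrite /talg ?rmorph1 // rmorphM tensM mulr1. Qed.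

HB.instance Definition _ := isPzComAlg.Build A tensor
  talg_is_zmod_morphism talg_is_monoid_morphism.

Lemma algmap_tensl (a : A) : algmap a = tens (algmap a) 1. Proof. by []. Qed.
Lemma algmap_tensr (a : A) : algmap a = tens 1 (algmap a).
Proof. by rewrite algmap_tensl -[algmap a in LHS]mulr1 tensZ mulr1. Qed.

End Tensor.

Infix "⊗" := tensor (at level 40, left associativity).
Infix "⊗t" := tens (at level 40, left associativity).

Section TensorMaps.
Variable A : comPzRingType.
Implicit Types S T R U V : pzComAlgType A.

Lemma tensor_homP S T R (f g : algHom (S ⊗ T) R) :
  (forall s t, f (s ⊗t t) = g (s ⊗t t)) -> f =1 g.
Proof.
move=> fg; case/tpi_case=> u; rewrite tpi_sum !rmorph_sum.
by apply: eq_bigr => -[s t] _; apply: fg.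
Qed.

Definition copair_fun S T R (f : algHom S R) (g : algHom T R) (x : S ⊗ T) : R :=
  \sum_(p <- repr x) f p.1 * g p.2.

Lemma copair_funE S T R (f : algHom S R) (g : algHom T R) u :
  copair_fun f g (tpi u) = \sum_(p <- u) f p.1 * g p.2.
Proof.
rewrite /copair_fun; move: (repr _) (tcong_repr u) => v.
elim=> {u v} //=.
- by move=> u v w _ -> _ ->.
- by move=> u u' v v' _ Eu _ Ev; rewrite !big_cat /= Eu Ev.
- by move=> u v; rewrite !big_cat /= addrC.
- by move=> t; rewrite big_seq1 big_nil rmorph0 mul0r.
- by move=> s s' t; rewrite big_seq1 big_cons big_seq1 /= rmorphD mulrDl.
- by move=> s t t'; rewrite big_seq1 big_cons big_seq1 /= rmorphD mulrDr.
- by move=> a s t; rewrite !big_seq1 /= !rmorphM /= !algHom_algmap -mulrA mulrCA.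
Qed.

Lemma copair_is_algHom S T R (f : algHom S R) (g : algHom T R) :
  is_algHom (copair_fun f g).
Proof.
have cD x y : copair_fun f g (x + y) = copair_fun f g x + copair_fun f g y.
  case/tpi_case: x => u; case/tpi_case: y => v.
  by rewrite -tensorDE !copair_funE big_cat.
split=> [x y||a]; last 1 first.
- by rewrite algmap_tensl copair_funE big_seq1 /= rmorph1 mulr1 algHom_algmap.
- by apply: (addIr (copair_fun f g y)); rewrite -cD !subrK.
split; first by rewrite -tens1 copair_funE big_seq1 /= !rmorph1 mulr1.
case/tpi_case=> u; case/tpi_case=> v; rewrite [_ * _]tmulE !copair_funE.
rewrite big_allpairs_dep /= mulr_suml; apply: eq_bigr => p _.
rewrite mulr_sumr; apply: eq_bigr => q _ /=.
by rewrite !rmorphM mulrACA.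
Qed.

(* s (x) t |-> f s * g t *)
Definition copair S T R (f : algHom S R) (g : algHom T R) : algHom (S ⊗ T) R :=
  AlgHom (copair_is_algHom f g).

Lemma copairE S T R (f : algHom S R) (g : algHom T R) s t :
  copair f g (s ⊗t t) = f s * g t.
Proof. by rewrite /= copair_funE big_seq1. Qed.

Arguments copair : simpl never.

Lemma inl_is_algHom S T : is_algHom (fun s : S => s ⊗t (1 : T)).
Proof.
split=> [x y|| a]; first exact: tensBl; last by rewrite algmap_tensl.
by split=> [|x y]; rewrite ?tensM ?mulr1.
Qed.
Definition tinl S T : algHom S (S ⊗ T) := AlgHom (@inl_is_algHom S T).

Lemma inr_is_algHom S T : is_algHom (fun t : T => (1 : S) ⊗t t).
Proof.
split=> [x y|| a]; first exact: tensBr; last by rewrite algmap_tensr.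
by split=> [|x y]; rewrite ?tensM ?mulr1.
Qed.
Definition tinr S T : algHom T (S ⊗ T) := AlgHom (@inr_is_algHom S T).

Definition tmap S T S' T' (f : algHom S S') (g : algHom T T') :
    algHom (S ⊗ T) (S' ⊗ T') :=
  copair (tinl S' T' \oH f) (tinr S' T' \oH g).

Lemma tmapE S T S' T' (f : algHom S S') (g : algHom T T') s t :
  tmap f g (s ⊗t t) = f s ⊗t g t.
Proof. by rewrite copairE /= tensM mulr1 mul1r. Qed.

Definition tswap S T : algHom (S ⊗ T) (T ⊗ S) :=
  copair (tinr T S) (tinl T S).

Lemma tswapE S T (s : S) (t : T) : tswap S T (s ⊗t t) = t ⊗t s.
Proof. by rewrite copairE /= tensM mulr1 mul1r. Qed.

Definition tassoc S T U : algHom ((S ⊗ T) ⊗ U) (S ⊗ (T ⊗ U)) :=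
  copair (copair (tinl S (T ⊗ U)) (tinr S (T ⊗ U) \oH tinl T U))
         (tinr S (T ⊗ U) \oH tinr T U).

Lemma tassocE S T U (s : S) (t : T) (u : U) :
  tassoc S T U ((s ⊗t t) ⊗t u) = s ⊗t (t ⊗t u).
Proof. by rewrite !copairE /= !tensM !mulr1 !mul1r. Qed.

(* the dual of (x, (y, z)) |-> ((x, y), (x, z)) *)
Definition tfold S : algHom ((S ⊗ S) ⊗ (S ⊗ S)) (S ⊗ (S ⊗ S)) :=
  copair (tmap (idHom S) (tinl S S)) (tmap (idHom S) (tinr S S)).

Lemma tfoldE S (s t s' t' : S) :
  tfold S ((s ⊗t t) ⊗t (s' ⊗t t')) = (s * s') ⊗t (t ⊗t t').
Proof. by rewrite !copairE /= !tensM !mulr1 !mul1r. Qed.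

Arguments tmap : simpl never.
Arguments tswap : simpl never.
Arguments tassoc : simpl never.
Arguments tfold : simpl never.

Lemma comp_copair S T R R' (h : algHom R R') (f : algHom S R) (g : algHom T R) :
  h \oH copair f g = copair (h \oH f) (h \oH g).
Proof.
apply: algHom_ext; apply: tensor_homP => s t.
by rewrite !(compHomE, copairE) rmorphM.
Qed.

Lemma copair_tmap S T S' T' R (f : algHom S S') (g : algHom T T')
    (h : algHom S' R) (k : algHom T' R) :
  copair h k \oH tmap f g = copair (h \oH f) (k \oH g).
Proof.
apply: algHom_ext; apply: tensor_homP => s t.
by rewrite compHomE tmapE !copairE.
Qed.

Lemma copair_tswap S T R (f : algHom S R) (g : algHom T R) :
  copair g f \oH tswap S T = copair f g.
Proof.
apply: algHom_ext; apply: tensor_homP => s t.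
by rewrite compHomE tswapE !copairE mulrC.
Qed.

Lemma copair_inl S T R (f : algHom S R) (g : algHom T R) :
  copair f g \oH tinl S T = f.
Proof. by apply: algHom_ext => s; rewrite [LHS](copairE f g s 1) rmorph1 mulr1. Qed.

Lemma copair_inr S T R (f : algHom S R) (g : algHom T R) :
  copair f g \oH tinr S T = g.
Proof. by apply: algHom_ext => s; rewrite [LHS](copairE f g 1 s) rmorph1 mul1r. Qed.

Lemma compHomA S T R U (h : algHom R U) (g : algHom T R) (f : algHom S T) :
  h \oH (g \oH f) = (h \oH g) \oH f.
Proof. exact: algHom_ext. Qed.

Lemma compHom1 S R (f : algHom S R) : f \oH idHom S = f.
Proof. exact: algHom_ext. Qed.

Lemma comp1Hom S R (f : algHom S R) : idHom R \oH f = f.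
Proof. exact: algHom_ext. Qed.

Lemma copair_tassoc S T U R (f : algHom S R) (g : algHom T R) (h : algHom U R) :
  copair f (copair g h) \oH tassoc S T U = copair (copair f g) h.
Proof. by rewrite !comp_copair !compHomA copair_inl copair_inr copair_inl
  copair_inr. Qed.

Lemma copair_tfold S R (f g h : algHom S R) :
  copair f (copair g h) \oH tfold S = copair (copair f g) (copair f h).
Proof.
by rewrite comp_copair !copair_tmap !compHom1 copair_inl copair_inr.
Qed.

End TensorMaps.

Section Biring.
Variables (A B : comPzRingType).

(* A B-algebra object in the opposite category of A-algebras; the co-zero and *)
(* co-one are [coscal 0] and [coscal 1]. The last two fields state that       *)
(* [coscal] is a ring homomorphism from B to Hom_A(S, A).                     *)
Record biring (S : pzComAlgType A) := Biring {
  coadd : algHom S (S ⊗ S);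
  comul : algHom S (S ⊗ S);
  coneg : algHom S S;
  coscal : B -> algHom S A^o;
  coaddA : tmap (idHom S) coadd \oH coadd
             = tassoc S S S \oH tmap coadd (idHom S) \oH coadd;
  coaddC : tswap S S \oH coadd = coadd;
  coadd0 : copair (unitHom S \oH coscal 0) (idHom S) \oH coadd = idHom S;
  coaddN : copair coneg (idHom S) \oH coadd = unitHom S \oH coscal 0;
  comulA : tmap (idHom S) comul \oH comul
             = tassoc S S S \oH tmap comul (idHom S) \oH comul;
  comulC : tswap S S \oH comul = comul;
  comul1 : copair (unitHom S \oH coscal 1) (idHom S) \oH comul = idHom S;
  comulDr : tmap (idHom S) coadd \oH comul
              = tfold S \oH tmap comul comul \oH coadd;
  coscalD : forall b c,
    coscal (b + c) = copair (coscal b) (coscal c) \oH coadd;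
  coscalM : forall b c,
    coscal (b * c) = copair (coscal b) (coscal c) \oH comul
}.

Definition is_biringHom (S T : pzComAlgType A) (H : biring S) (K : biring T)
    (h : algHom S T) : Prop :=
  [/\ tmap h h \oH coadd H = coadd K \oH h,
      tmap h h \oH comul H = comul K \oH h
    & forall b, coscal K b \oH h = coscal H b].

(* An alias of Hom_A(S, R), so that the B-algebra structure determined by the *)
(* biring H can be canonical on it.                                           *)
Definition homAlg (S : pzComAlgType A) (H : biring S) (R : pzComAlgType A) :=
  algHom S R.

HB.instance Definition _ S (H : biring S) R := Choice.on (homAlg H R).

Section HomAlg.
Variables (S : pzComAlgType A) (H : biring S) (R : pzComAlgType A).
Implicit Types f g h : homAlg H R.

Definition hconst (b : B) : homAlg H R := unitHom R \oH coscal H b.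
Definition hadd f g : homAlg H R := copair f g \oH coadd H.
Definition hopp f : homAlg H R := f \oH coneg H.
Definition hmul f g : homAlg H R := copair f g \oH comul H.

Lemma comp_unitHom (T U : pzComAlgType A) (f : algHom T U) :
  f \oH unitHom T = unitHom U.
Proof. by apply: algHom_ext => a; apply: algHom_algmap. Qed.

Lemma haddA : associative hadd.
Proof.
move=> f g h; rewrite /hadd; transitivity
  (copair f (copair g h) \oH (tmap (idHom S) (coadd H) \oH coadd H)).
  by rewrite compHomA copair_tmap compHom1.
by rewrite coaddA !compHomA copair_tassoc copair_tmap compHom1.
Qed.

Lemma haddC : commutative hadd.
Proof.
by move=> f g; rewrite /hadd -[in LHS]coaddC compHomA copair_tswap.
Qed.

Lemma hadd0 : left_id (hconst 0) hadd.
Proof.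
move=> f; rewrite -[RHS](compHom1 f) -(coadd0 H) !compHomA comp_copair.
by rewrite !compHomA comp_unitHom compHom1.
Qed.

Lemma haddN : left_inverse (hconst 0) hopp hadd.
Proof.
move=> f; rewrite /hconst -(comp_unitHom f) -compHomA -(coaddN H).
by rewrite compHomA comp_copair compHom1.
Qed.

HB.instance Definition _ :=
  GRing.isZmodule.Build (homAlg H R) haddA haddC hadd0 haddN.

Lemma hmulA : associative hmul.
Proof.
move=> f g h; rewrite /hmul; transitivity
  (copair f (copair g h) \oH (tmap (idHom S) (comul H) \oH comul H)).
  by rewrite compHomA copair_tmap compHom1.
by rewrite comulA !compHomA copair_tassoc copair_tmap compHom1.
Qed.

Lemma hmulC : commutative hmul.
Proof.
by move=> f g; rewrite /hmul -[in LHS]comulC compHomA copair_tswap.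
Qed.

Lemma hmul1 : left_id (hconst 1) hmul.
Proof.
move=> f; rewrite -[RHS](compHom1 f) -(comul1 H) !compHomA comp_copair.
by rewrite !compHomA comp_unitHom compHom1.
Qed.

Lemma hmulDr : right_distributive hmul hadd.
Proof.
move=> f g h; rewrite /hmul /hadd; transitivity
  (copair f (copair g h) \oH (tmap (idHom S) (coadd H) \oH comul H)).
  by rewrite compHomA copair_tmap compHom1.
by rewrite comulDr !compHomA copair_tfold copair_tmap.
Qed.

Lemma hmulDl : left_distributive hmul +%R.
Proof. by move=> f g h; rewrite !(hmulC _ h); apply: hmulDr. Qed.

HB.instance Definition _ := GRing.Zmodule_isComPzRing.Build (homAlg H R)
  hmulA hmulC hmul1 hmulDl.

Lemma hconstD b c : hconst (b + c) = hconst b + hconst c.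
Proof. by rewrite /hconst coscalD compHomA comp_copair. Qed.

Lemma hconstM b c : hconst (b * c) = hconst b * hconst c.
Proof. by rewrite /hconst coscalM compHomA comp_copair. Qed.

Lemma hconst_is_zmod_morphism : zmod_morphism hconst.
Proof.
by move=> b c; apply: (addIr (hconst c)); rewrite -hconstD !subrK.
Qed.
Lemma hconst_is_monoid_morphism : monoid_morphism hconst.
Proof. by split=> [//|b c]; rewrite hconstM. Qed.

HB.instance Definition _ := isPzComAlg.Build B (homAlg H R)
  hconst_is_zmod_morphism hconst_is_monoid_morphism.

End HomAlg.
End Biring.

Section Functors.
Variables (D : comPzRingType).

Record algFunctor := AlgFunctor {
  fobj : pzComAlgType D -> pzComAlgType D;
  fmap : forall R R', algHom R R' -> algHom (fobj R) (fobj R');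
  fmap1 : forall R, fmap (idHom R) = idHom (fobj R);
  fmapM : forall R R' R'' (g : algHom R' R'') (f : algHom R R'),
    fmap (g \oH f) = fmap g \oH fmap f
}.

Record setFunctor := SetFunctor {
  sobj : pzComAlgType D -> Type;
  smap : forall R R', algHom R R' -> sobj R -> sobj R';
  smap1 : forall R, smap (idHom R) = id;
  smapM : forall R R' R'' (g : algHom R' R'') (f : algHom R R'),
    smap (g \oH f) = smap g \o smap f
}.

Definition forgetful (F : algFunctor) : setFunctor.
Proof.
refine (@SetFunctor (fun R => fobj F R) (fun R R' f => fmap F f) _ _).
- by move=> R; rewrite fmap1.
- by move=> R R' R'' g f; rewrite fmapM.
Defined.

Definition homFunctor (S : pzComAlgType D) : setFunctor.
Proof.
refine (@SetFunctor (fun R => algHom S R) (fun R R' f phi => f \oH phi) _ _).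
- by move=> R; apply: funext => phi; rewrite comp1Hom.
- by move=> R R' R'' g f; apply: funext => phi; rewrite /= compHomA.
Defined.

Definition is_lift (S : pzComAlgType D) (F : algFunctor) : Prop :=
  forgetful F = homFunctor S.

End Functors.

Section PolyBiring.
Variable A : comNzRingType.

Lemma polyC_is_zmod_morphism : zmod_morphism (@polyC A).
Proof. exact: polyCB. Qed.
Lemma polyC_is_monoid_morphism : monoid_morphism (@polyC A).
Proof. by split=> // a b; apply: polyCM. Qed.

HB.instance Definition _ := isPzComAlg.Build A {poly A}
  polyC_is_zmod_morphism polyC_is_monoid_morphism.

Section Eval.
Variables (R : pzComAlgType A) (r : R).

(* [map_poly] would need R to be nonzero *)
Definition peval (p : {poly A}) : R := \sum_(i < size p) algmap p`_i * r ^+ i.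

Lemma peval_widen n (p : {poly A}) : (size p <= n)%N ->
  peval p = \sum_(i < n) algmap p`_i * r ^+ i.
Proof.
move=> le_pn; rewrite /peval (big_ord_widen n (fun i => algmap p`_i * r ^+ i)) //.
rewrite big_mkcond; apply: eq_bigr => i _; case: ltnP => // le_pi.
by rewrite nth_default // rmorph0 mul0r.
Qed.

Lemma pevalD p q : peval (p + q) = peval p + peval q.
Proof.
pose n := maxn (size (p + q)) (maxn (size p) (size q)).
rewrite !(@peval_widen n) ?leq_max ?leqnn ?orbT //.
rewrite -big_split; apply: eq_bigr => i _ /=.
by rewrite coefD rmorphD mulrDl.
Qed.

Lemma pevalCM c p : peval (c%:P * p) = algmap c * peval p.
Proof.
pose n := maxn (size (c%:P * p)) (size p).
rewrite !(@peval_widen n) ?leq_max ?leqnn ?orbT //.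
rewrite mulr_sumr; apply: eq_bigr => i _ /=.
by rewrite coefCM rmorphM mulrA.
Qed.

Lemma peval0 : peval 0 = 0.
Proof. by rewrite /peval size_poly0 big_ord0. Qed.

Lemma pevalMX p : peval (p * 'X) = peval p * r.
Proof.
rewrite (@peval_widen (size p).+1); last first.
  by rewrite (leq_trans (size_polyMleq _ _)) // size_polyX addn2.
rewrite big_ord_recl coefMX /= rmorph0 mul0r add0r mulr_suml.
by apply: eq_bigr => i _; rewrite coefMX /= exprSr mulrA.
Qed.

Lemma pevalC c : peval c%:P = algmap c.
Proof.
rewrite (@peval_widen 1) ?size_polyC ?leq_b1 //.
by rewrite big_ord1 coefC expr0 mulr1.
Qed.

Lemma pevalX : peval 'X = r.
Proof. by rewrite -['X]mul1r pevalMX pevalC rmorph1 mul1r. Qed.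

Lemma peval_is_algHom : is_algHom peval.
Proof.
split=> [p q|| a]; last exact: pevalC.
  by apply: (addIr (peval q)); rewrite -pevalD !subrK.
split=> [|p q]; first by rewrite pevalC rmorph1.
elim/poly_ind: p => [|p c IH]; first by rewrite mul0r peval0 mul0r.
rewrite mulrDl !pevalD mulrAC (pevalMX (p * q)) IH pevalMX pevalC pevalCM.
by rewrite mulrDl mulrAC.
Qed.

Definition evalHom : algHom {poly A} R := AlgHom peval_is_algHom.

End Eval.

Lemma polyHom_ext (R : pzComAlgType A) (f g : algHom {poly A} R) :
  f 'X = g 'X -> f = g.
Proof.
move=> fgX; apply: algHom_ext; elim/poly_ind=> [|p c IH]; first by rewrite !rmorph0.
rewrite !rmorphD !rmorphM /= IH fgX; congr (_ + _).
by rewrite -[c%:P]/(algmap c) !algHom_algmap.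
Qed.

Lemma horner_is_algHom (a : A) :
  is_algHom (fun p : {poly A} => p.[a] : A^o).
Proof.
split=> [p q|| b]; first by rewrite !hornerE.
  by split=> [|p q]; rewrite !hornerE.
exact: hornerC.
Qed.
Definition hornerHom (a : A) : algHom {poly A} A^o :=
  AlgHom (horner_is_algHom a).

Definition polyX_coadd : algHom {poly A} ({poly A} ⊗ {poly A}) :=
  evalHom ('X ⊗t 1 + 1 ⊗t 'X).
Definition polyX_comul : algHom {poly A} ({poly A} ⊗ {poly A}) :=
  evalHom ('X ⊗t 'X).
Definition polyX_coneg : algHom {poly A} {poly A} := evalHom (- 'X).

Lemma polyX_coaddX : polyX_coadd 'X = 'X ⊗t 1 + 1 ⊗t 'X.
Proof. exact: pevalX. Qed.
Lemma polyX_comulX : polyX_comul 'X = 'X ⊗t 'X.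
Proof. exact: pevalX. Qed.
Lemma polyX_conegX : polyX_coneg 'X = - 'X.
Proof. exact: pevalX. Qed.
Lemma idHomE (R : pzComAlgType A) (x : R) : idHom R x = x. Proof. by []. Qed.
Lemma hornerHomX (a : A) : hornerHom a 'X = a. Proof. exact: hornerX. Qed.

Lemma copair_coaddX (R : pzComAlgType A) (f g : algHom {poly A} R) :
  (copair f g \oH polyX_coadd) 'X = f 'X + g 'X.
Proof. by rewrite compHomE polyX_coaddX algHomD 2!copairE 2!algHom1 mulr1 mul1r. Qed.

Lemma copair_comulX (R : pzComAlgType A) (f g : algHom {poly A} R) :
  (copair f g \oH polyX_comul) 'X = f 'X * g 'X.
Proof. by rewrite compHomE polyX_comulX copairE. Qed.

Definition polyX_biring : biring A {poly A}.
Proof.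
apply: (@Biring A A {poly A} polyX_coadd polyX_comul polyX_coneg hornerHom);
  try move=> b c; apply: polyHom_ext.
- rewrite 3!compHomE polyX_coaddX 2!algHomD 4!tmapE 2!idHomE polyX_coaddX.
  by rewrite algHom1 tensDr tensDl 2!algHomD 3!tassocE addrA.
- by rewrite compHomE polyX_coaddX algHomD 2!tswapE addrC.
- by rewrite copair_coaddX compHomE hornerHomX [unitHom _ _]rmorph0 add0r.
- by rewrite copair_coaddX compHomE hornerHomX [unitHom _ _]rmorph0
    polyX_conegX addNr.
- by rewrite 3!compHomE polyX_comulX 2!tmapE idHomE polyX_comulX tassocE.
- by rewrite compHomE polyX_comulX tswapE.
- by rewrite copair_comulX compHomE hornerHomX [unitHom _ _]rmorph1 mul1r.
- rewrite 3!compHomE polyX_comulX polyX_coaddX tmapE idHomE polyX_coaddX.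
  rewrite 2!algHomD 2!tmapE polyX_comulX algHom1 2!tfoldE tensDr.
  by rewrite mulr1 mul1r.
- by rewrite copair_coaddX !hornerHomX.
- by rewrite copair_comulX !hornerHomX.
Defined.
End PolyBiring.

Section IntegerValued.
Variable D : idomainType.

Local Notation tofrac := (@FracField.tofrac D).
Local Notation "x %:F" := (tofrac x).

(* the set Int(D) in K[X], with K = {fraction D} *)
Definition intPoly : {pred {poly {fraction D}}} :=
  fun f => `[< forall d : D, exists c : D, f.[d%:F] = c%:F >].

Lemma intPolyP (f : {poly {fraction D}}) :
  reflect (forall d : D, exists c : D, f.[d%:F] = c%:F) (f \in intPoly).
Proof. exact: asboolP. Qed.

Lemma intPoly_subring : subring_closed intPoly.
Proof.
split=> [|f g|f g].
- by apply/intPolyP => d; exists 1; rewrite hornerC rmorph1.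
- move=> /intPolyP fP /intPolyP gP; apply/intPolyP => d.
  have [[a fa] [b gb]] := (fP d, gP d).
  by exists (a - b); rewrite !hornerE fa gb rmorphB.
- move=> /intPolyP fP /intPolyP gP; apply/intPolyP => d.
  have [[a fa] [b gb]] := (fP d, gP d).
  by exists (a * b); rewrite !hornerE fa gb rmorphM.
Qed.
HB.instance Definition _ :=
  GRing.isSubringClosed.Build {poly {fraction D}} intPoly intPoly_subring.

Record intD := IntD {
  intD_val :> {poly {fraction D}};
  intD_valP : intD_val \in intPoly
}.
HB.instance Definition _ := [isSub for intD_val].
HB.instance Definition _ := [Choice of intD by <:].
HB.instance Definition _ := [SubChoice_isSubComNzRing of intD by <:].

Lemma map_tofrac_int (p : {poly D}) : map_poly tofrac p \in intPoly.
Proof.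
by apply/intPolyP => d; exists p.[d]; rewrite horner_map.
Qed.

Definition polyInt (p : {poly D}) : intD := IntD (map_tofrac_int p).

Lemma polyInt_zmod : zmod_morphism polyInt.
Proof. by move=> p q; apply: val_inj; rewrite /= !rmorphB. Qed.
Lemma polyInt_monoid : monoid_morphism polyInt.
Proof.
by split=> [|p q]; apply: val_inj; rewrite /= ?rmorph1 // rmorphM.
Qed.

Definition constInt (d : D) : intD := polyInt d%:P.

Lemma constInt_zmod : zmod_morphism constInt.
Proof. by move=> d e; rewrite /constInt polyCB polyInt_zmod. Qed.
Lemma constInt_monoid : monoid_morphism constInt.
Proof.
split=> [|d e]; first by rewrite /constInt polyInt_monoid.
by rewrite /constInt polyCM polyInt_monoid.
Qed.
HB.instance Definition _ := isPzComAlg.Build D intD constInt_zmod constInt_monoid.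

Lemma polyInt_is_algHom : is_algHom polyInt.
Proof. by split; [exact: polyInt_zmod|exact: polyInt_monoid|]. Qed.

Definition polyIntHom : algHom {poly D} intD := AlgHom polyInt_is_algHom.

Definition intX : intD := polyInt 'X.

Lemma intXE : intX = 'X :> {poly {fraction D}}.
Proof. by rewrite /= map_polyX. Qed.

End IntegerValued.

(* Main.v *)
(* Yoneda: an operation on Hom_A(S, R), natural in R, is composition with its *)
(* value at the universal pair of coprojections S -> S (x) S (at id_S for     *)
(* unary operations, at the initial algebra A for constants), and the laws of *)
(* a biring are the algebra laws at the coprojections into tensor powers.     *)
(* For (2), homomorphisms out of A[X] are determined by the image of X, and   *)
(* evaluation at X preserves sums, products and constants for every algebra   *)
(* if and only if it does so on these universal elements.                     *)
Require Import Defs.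
From HB Require Import structures.
From mathcomp Require Import all_boot all_order all_algebra.
From mathcomp Require Import boolp.

Set Implicit Arguments.
Unset Strict Implicit.
Unset Printing Implicit Defensive.

Import GRing.Theory.
Local Open Scope ring_scope.

(** Part (1) is proved for any [D]-algebra [S]. A biring makes each Hom(S, R) an algebra, naturally
    in [R] ([liftFunctor_is_lift]); conversely a lift yields the structure maps by Yoneda
    ([biring_of_lift]). In (2) both sides reduce to the same three equations for [coadd], [comul]
    and [coscal] at [intX] ([polyInt_biringHomP], [eval_is_algHomP]). *)

Lemma copair_inlr (A : comPzRingType) (S T : pzComAlgType A) :
  copair (tinl S T) (tinr S T) = idHom (S ⊗ T).
Proof.
apply: algHom_ext; apply: tensor_homP => s t.
by rewrite copairE /= tensM mulr1 mul1r.
Qed.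

Section StructureMaps.
Variable A : comPzRingType.
Implicit Types S T U R : pzComAlgType A.

Lemma comp_tmap S T S' T' R (f : algHom S S') (g : algHom T T')
    (h : algHom (S' ⊗ T') R) :
  h \oH tmap f g = copair (h \oH tinl S' T' \oH f) (h \oH tinr S' T' \oH g).
Proof. by rewrite comp_copair !compHomA. Qed.

Lemma tassoc_inl S T U :
  tassoc S T U \oH tinl (S ⊗ T) U
    = copair (tinl S (T ⊗ U)) (tinr S (T ⊗ U) \oH tinl T U).
Proof. exact: copair_inl. Qed.

Lemma tassoc_inr S T U :
  tassoc S T U \oH tinr (S ⊗ T) U = tinr S (T ⊗ U) \oH tinr T U.
Proof. exact: copair_inr. Qed.

Lemma tfold_inl S :
  tfold S \oH tinl (S ⊗ S) (S ⊗ S) = tmap (idHom S) (tinl S S).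
Proof. exact: copair_inl. Qed.

Lemma tfold_inr S :
  tfold S \oH tinr (S ⊗ S) (S ⊗ S) = tmap (idHom S) (tinr S S).
Proof. exact: copair_inr. Qed.

End StructureMaps.

Section LiftOfBiring.
Variables (D : comPzRingType) (S : pzComAlgType D) (H : biring D S).

(** Operations on [homAlg] precompose with the structure maps of [H], whereas [f] composes on the
    other side and passes through [copair] and [unitHom]. *)
Lemma comp_is_algHom_homAlg (R R' : pzComAlgType D) (f : algHom R R') :
  is_algHom (fun phi : homAlg H R => f \oH phi : homAlg H R').
Proof.
have fD (phi psi : homAlg H R) :
    f \oH (phi + psi) = (f \oH phi : homAlg H R') + (f \oH psi : homAlg H R').
  by rewrite [LHS]compHomA comp_copair.
split=> [phi psi||b].
- by apply: (addIr (f \oH psi : homAlg H R')); rewrite -fD !subrK.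
- split=> [|phi psi]; last by rewrite [LHS]compHomA comp_copair.
  by rewrite [LHS]compHomA comp_unitHom.
- by rewrite [LHS]compHomA comp_unitHom.
Qed.

Definition liftMap (R R' : pzComAlgType D) (f : algHom R R') :
    algHom (homAlg H R) (homAlg H R') :=
  AlgHom (comp_is_algHom_homAlg f).

Lemma liftMap1 R : liftMap (idHom R) = idHom (homAlg H R).
Proof. by apply: algHom_ext => phi; apply: comp1Hom. Qed.

Lemma liftMapM (R R' R'' : pzComAlgType D)
    (g : algHom R' R'') (f : algHom R R') :
  liftMap (g \oH f) = liftMap g \oH liftMap f.
Proof. by apply: algHom_ext => phi; rewrite /= -compHomA. Qed.

Definition liftFunctor : algFunctor D := AlgFunctor liftMap1 liftMapM.

(** [homAlg H R] unfolds to [algHom S R], so the two functors differ only in their proofs of the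
    functor laws. *)
Lemma liftFunctor_is_lift : is_lift S liftFunctor.
Proof.
rewrite /is_lift /forgetful /homFunctor.
congr SetFunctor; exact: Prop_irrelevance.
Qed.

End LiftOfBiring.

(** Replaces an equality of functors by a natural bijection, so that no transport between carrier
    types is needed later. *)
Lemma setFunctor_eq_iso (D : comPzRingType) (G G' : setFunctor D) : G = G' ->
  exists (e : forall R, sobj G R -> sobj G' R)
         (u : forall R, sobj G' R -> sobj G R),
  [/\ forall R, cancel (e R) (u R), forall R, cancel (u R) (e R)
    & forall R R' (f : algHom R R') x,
        u R' (smap f x) = smap f (u R x)].
Proof. by move=> <-; exists (fun _ => id), (fun _ => id). Qed.

Section BiringOfLift.
Variables (D : comPzRingType) (S : pzComAlgType D) (F : algFunctor D).
Variables (e : forall R, fobj F R -> algHom S R)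
          (u : forall R, algHom S R -> fobj F R).
Hypotheses (eK : forall R, cancel (@e R) (@u R))
           (uK : forall R, cancel (@u R) (@e R)).
Hypothesis uC : forall R R' (f : algHom R R') (phi : algHom S R),
  u (f \oH phi) = fmap F f (u phi).

Let coadd' := e (u (tinl S S) + u (tinr S S)).
Let comul' := e (u (tinl S S) * u (tinr S S)).
Let coneg' := e (- u (idHom S)).
Let coscal' (b : D) : algHom S D^o := e (algmap b).

Let u_inj R : injective (@u R). Proof. exact: can_inj (@uK R). Qed.

(** [copair f g] sends the universal pair of coprojections to [f], [g], and its image under [F]
    preserves sums. *)
Let u_coadd R (f g : algHom S R) : u (copair f g \oH coadd') = u f + u g.
Proof. by rewrite uC eK rmorphD /= -!uC copair_inl copair_inr. Qed.

Let u_comul R (f g : algHom S R) : u (copair f g \oH comul') = u f * u g.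
Proof. by rewrite uC eK rmorphM /= -!uC copair_inl copair_inr. Qed.

Let u_coscal R b : u (unitHom R \oH coscal' b) = algmap b.
Proof. by rewrite uC eK algHom_algmap. Qed.

Let u_comp_coadd R (f : algHom (S ⊗ S) R) :
  u (f \oH coadd') = u (f \oH tinl S S) + u (f \oH tinr S S).
Proof. by rewrite uC eK rmorphD /= -!uC. Qed.

Let u_comp_comul R (f : algHom (S ⊗ S) R) :
  u (f \oH comul') = u (f \oH tinl S S) * u (f \oH tinr S S).
Proof. by rewrite uC eK rmorphM /= -!uC. Qed.

Let u_tmap_comul R T (f : algHom S R) (g : algHom S T) :
  u (tmap f g \oH comul') = u (tinl R T \oH f) * u (tinr R T \oH g).
Proof. exact: u_comul. Qed.

(** Applying the injection [u] turns each biring law into the matching algebra law in some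
    [fobj F R]. *)
Lemma biring_of_lift : biring D S.
Proof.
apply: (@Biring D D S coadd' comul' coneg' coscal'); try move=> b c;
  apply: u_inj.
- rewrite comp_tmap tassoc_inl tassoc_inr compHom1 !u_coadd.
  by rewrite u_comp_coadd addrA compHom1.
- by rewrite u_coadd eK addrC.
- by rewrite u_coadd u_coscal rmorph0 add0r.
- by rewrite u_coadd u_coscal eK addNr rmorph0.
- rewrite comp_tmap tassoc_inl tassoc_inr compHom1 !u_comul.
  by rewrite u_comp_comul mulrA compHom1.
- by rewrite u_comul eK mulrC.
- by rewrite u_comul u_coscal rmorph1 mul1r.
- rewrite comp_tmap tfold_inl tfold_inr u_coadd !u_tmap_comul.
  by rewrite u_comp_coadd mulrDr !compHom1.
- by rewrite u_coadd !eK rmorphD.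
- by rewrite u_comul !eK rmorphM.
Qed.

End BiringOfLift.

Lemma polyInt_biringHomP (D : idomainType) (H : biring D (intD D)) :
  is_biringHom (polyX_biring D) H (polyIntHom D) <->
  [/\ coadd H (intX D) = intX D ⊗t 1 + 1 ⊗t intX D,
      comul H (intX D) = intX D ⊗t intX D
    & forall b, coscal H b (intX D) = b].
Proof.
have hX : polyIntHom D 'X = intX D by [].
have haX : (tmap (polyIntHom D) (polyIntHom D) \oH polyX_coadd D) 'X
    = intX D ⊗t 1 + 1 ⊗t intX D.
  by rewrite compHomE polyX_coaddX algHomD !tmapE algHom1.
have hmX : (tmap (polyIntHom D) (polyIntHom D) \oH polyX_comul D) 'X
    = intX D ⊗t intX D.
  by rewrite compHomE polyX_comulX tmapE.
split=> [[Ha Hm Hb]|[Ha Hm Hb]].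
  split=> [||b]; first by rewrite -haX [_ \oH _]Ha.
    by rewrite -hmX [_ \oH _]Hm.
  by rewrite -[RHS](hornerHomX b) -[hornerHom b]Hb.
split=> [||b]; apply: polyHom_ext.
- by rewrite [LHS]haX -Ha.
- by rewrite [LHS]hmX -Hm.
- by rewrite [RHS](hornerHomX b) compHomE hX Hb.
Qed.

Lemma eval_is_algHomP (D : comPzRingType) (S : pzComAlgType D)
    (H : biring D S) (x : S) :
  (forall A : pzComAlgType D, is_algHom (fun phi : homAlg H A => phi x)) <->
  [/\ coadd H x = x ⊗t 1 + 1 ⊗t x, comul H x = x ⊗t x
    & forall b, coscal H b x = b].
Proof.
split=> [evP|[xa xm xb] A].
  have [evB [_ evM] _] := evP (S ⊗ S).
  pose i : homAlg H (S ⊗ S) := tinl S S; pose j : homAlg H (S ⊗ S) := tinr S S.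
  (* The coprojections pair to the identity, so their sum and product are the structure maps
     themselves. *)
  have ijD : i + j = coadd H by rewrite -[RHS]comp1Hom -copair_inlr.
  have ijM : i * j = comul H by rewrite -[RHS]comp1Hom -copair_inlr.
  (* Over [D^o] the constant [b] of [homAlg] is [coscal H b] itself. *)
  split=> [||b]; last by have [_ _ ->] := evP D^o.
    (* [evB] concerns differences, so it is applied to [i = (i + j) - j]. *)
    have -> : x ⊗t 1 = coadd H x - j x by rewrite -ijD -(evB (i + j) j) addrK.
    by rewrite subrK.
  by have := evM i j; rewrite ijM => ->; rewrite tensM mulr1 mul1r.
have evC b : (algmap b : homAlg H A) x = algmap b.
  by rewrite [algmap b]/(unitHom A \oH coscal H b) compHomE xb.
have evD (phi psi : homAlg H A) : (phi + psi) x = phi x + psi x.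
  by rewrite [phi + psi]/(copair phi psi \oH coadd H) compHomE xa
    algHomD !copairE !algHom1 mulr1 mul1r.
split=> [phi psi||//].
  by apply: (addIr (psi x)); rewrite -evD !subrK.
split=> [|phi psi]; first by rewrite -(rmorph1 algmap) evC rmorph1.
by rewrite [phi * psi]/(copair phi psi \oH comul H) compHomE xm copairE.
Qed.

Theorem proposition3 (D : idomainType) :
  (inhabited (biring D (intD D))
     <-> exists F : algFunctor D, is_lift (intD D) F)
  /\
  (forall H : biring D (intD D),
     is_biringHom (polyX_biring D) H (polyIntHom D)
       <-> forall A : pzComAlgType D,
             is_algHom (fun phi : homAlg H A => phi (intX D))).
Proof.
split=> [|H]; last by rewrite polyInt_biringHomP eval_is_algHomP.
split=> [[H]|[F /setFunctor_eq_iso [e [u [eK uK uC]]]]].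
  by exists (liftFunctor H); apply: liftFunctor_is_lift.
by split; apply: (biring_of_lift eK uK uC).
Qed.
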